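(* Let $A\in\mathbb{R}^{n\times n}$ (not necessarily symmetric) be positive definite, i.e., there is $\delta>0$ such that $\langle Ax,x\rangle\ge \delta |x|^2$ for all $x\in\mathbb{R}^n$, and let $b\in\mathbb{R}^n$. Write $A_s=\frac12(A+A^T)$ and $A_a=\frac12(A-A^T)$. Then the functional $I:\mathbb{R}^n\to\mathbb{R}$, $$I(x)=\frac12\langle Ax,x\rangle+\frac12\langle A_s^{-1}(b-A_ax),\,b-A_ax\rangle-\langle b,x\rangle ,$$ is convex and continuous, and it attains its minimum at some $\bar x\in\mathbb{R}^n$ in such a way that $$I(\bar x)=\inf_{x\in\mathbb{R}^n}I(x)=0\qquad\text{and}\qquad A\bar x=b.$$
   Context: $\langle\cdot,\cdot\rangle$ and $|\cdot|$ denote the Euclidean inner product and norm on $\mathbb{R}^n$. $A_s$ and $A_a$ are the symmetric and anti-symmetric parts of $A$, so $A=A_s+A_a$. *)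

(* Defs.v *)
From mathcomp Require Import all_boot all_order all_algebra.
From mathcomp Require Import all_classical all_reals all_analysis.
Set Implicit Arguments.
Unset Strict Implicit.
Unset Printing Implicit Defensive.
Import Order.TTheory GRing.Theory Num.Theory.
Import numFieldNormedType.Exports.
Local Open Scope ring_scope.

Definition dot (R : realType) (n : nat) (x y : 'cV[R]_n) : R :=
  \sum_(i < n) x i 0 * y i 0.

(* The library norm `|x| on matrices is the sup norm. *)
Definition enorm (R : realType) (n : nat) (x : 'cV[R]_n) : R :=
  Num.sqrt (dot x x).

Definition posdef (R : realType) (n : nat) (A : 'M[R]_n) : Prop :=
  exists2 delta : R, 0 < delta &
    forall x : 'cV[R]_n, delta * enorm x ^+ 2 <= dot (A *m x) x.

Definition sympart (R : realType) (n : nat) (A : 'M[R]_n) : 'M[R]_n :=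
  2^-1 *: (A + A^T).

Definition antisympart (R : realType) (n : nat) (A : 'M[R]_n) : 'M[R]_n :=
  2^-1 *: (A - A^T).

Definition functional (R : realType) (n : nat) (A : 'M[R]_n) (b : 'cV[R]_n)
    (x : 'cV[R]_n) : R :=
  let r := b - antisympart A *m x in
  2^-1 * dot (A *m x) x + 2^-1 * dot (invmx (sympart A) *m r) r - dot b x.

Lemma dotE (R : realType) (n : nat) (x y : 'cV[R]_n) :
  dot x y = (x^T *m y) 0 0.
Proof. by rewrite mxE; apply: eq_bigr => i _; rewrite mxE. Qed.

Lemma dotC (R : realType) (n : nat) (x y : 'cV[R]_n) : dot x y = dot y x.
Proof. by apply: eq_bigr => i _; rewrite mulrC. Qed.

Lemma dotDl (R : realType) (n : nat) (x y z : 'cV[R]_n) :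
  dot (x + y) z = dot x z + dot y z.
Proof.
by rewrite -big_split /=; apply: eq_bigr => i _; rewrite mxE mulrDl.
Qed.

Lemma dotZl (R : realType) (n : nat) (a : R) (x y : 'cV[R]_n) :
  dot (a *: x) y = a * dot x y.
Proof. by rewrite /dot mulr_sumr; apply: eq_bigr => i _; rewrite mxE mulrA. Qed.

Lemma dot_ge0 (R : realType) (n : nat) (x : 'cV[R]_n) : 0 <= dot x x.
Proof. by apply: sumr_ge0 => i _; rewrite -expr2 sqr_ge0. Qed.

Lemma dot_eq0 (R : realType) (n : nat) (x : 'cV[R]_n) : dot x x = 0 -> x = 0.
Proof.
move=> /eqP; rewrite psumr_eq0 => [/allP x0|i _]; last by rewrite -expr2 sqr_ge0.
apply/matrixP => i j; rewrite ord1 mxE.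
by have := x0 i (mem_index_enum i); rewrite /= mulf_eq0 orbb => /eqP.
Qed.

Lemma dot_sympart (R : realType) (n : nat) (A : 'M[R]_n) (x : 'cV[R]_n) :
  dot (sympart A *m x) x = dot (A *m x) x.
Proof.
have AT : dot (A^T *m x) x = dot (A *m x) x.
  by rewrite [RHS]dotC !dotE trmx_mul trmxK mulmxA.
rewrite /sympart -scalemxAl mulmxDl dotZl dotDl.
by rewrite AT mulrC mulrDl -splitr.
Qed.

(* Hence [invmx (sympart A)] in [functional] is a genuine inverse. *)
Lemma sympart_unitmx (R : realType) (n : nat) (A : 'M[R]_n) :
  posdef A -> sympart A \in unitmx.
Proof.
move=> [d d0 Ad]; rewrite -unitmx_tr -row_free_unit -kermx_eq0.
apply/eqP/row_matrixP => i; rewrite row0.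
set u := row i _.
have u0 : u *m (sympart A)^T = 0 by apply/sub_kermxP; exact: row_sub.
have v0 : sympart A *m u^T = 0 by rewrite -[sympart A]trmxK -trmx_mul u0 trmx0.
have := Ad u^T; rewrite -dot_sympart v0 /enorm sqr_sqrtr ?dot_ge0//.
rewrite [leRHS]dotE trmx0 mul0mx mxE pmulr_rle0// => le0.
apply: trmx_inj; rewrite trmx0; apply: dot_eq0; apply/eqP.
by rewrite eq_le le0 dot_ge0.
Qed.

(* Main.v *)
Require Import Defs.
From mathcomp Require Import all_boot all_order all_algebra.
From mathcomp Require Import all_classical all_reals all_analysis.
From mathcomp Require Import ring lra.
Import Order.TTheory GRing.Theory Num.Theory.
Import numFieldNormedType.Exports.
Local Open Scope classical_set_scope.
Local Open Scope ring_scope.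

(** The functional is the square completion
      [I x = 1/2 <A_s^-1 (A x - b), A x - b>],
    because [A x - b = A_s x - (b - A_a x)] and [<A_a x, x> = 0].  As [A_s^-1]
    is positive definite, [I] is a nonnegative convex quadratic function, and
    it vanishes at [A^-1 b]. *)

Lemma dotDr (R : realType) (n : nat) (x y z : 'cV[R]_n) :
  dot x (y + z) = dot x y + dot x z.
Proof. by rewrite dotC dotDl !(dotC x). Qed.

Lemma dotZr (R : realType) (n : nat) (a : R) (x y : 'cV[R]_n) :
  dot x (a *: y) = a * dot x y.
Proof. by rewrite dotC dotZl dotC. Qed.

Lemma dotNl (R : realType) (n : nat) (x y : 'cV[R]_n) :
  dot (- x) y = - dot x y.
Proof. by rewrite -scaleN1r dotZl mulN1r. Qed.

Lemma dotNr (R : realType) (n : nat) (x y : 'cV[R]_n) :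
  dot x (- y) = - dot x y.
Proof. by rewrite dotC dotNl dotC. Qed.

Lemma dot_mulmxl (R : realType) (n : nat) (M : 'M[R]_n) (x y : 'cV[R]_n) :
  dot (M *m x) y = dot x (M^T *m y).
Proof. by rewrite !dotE trmx_mul mulmxA. Qed.

Lemma tr_sympart (R : realType) (n : nat) (A : 'M[R]_n) :
  (sympart A)^T = sympart A.
Proof. by rewrite /sympart linearZ/= linearD/= trmxK addrC. Qed.

Lemma tr_antisympart (R : realType) (n : nat) (A : 'M[R]_n) :
  (antisympart A)^T = - antisympart A.
Proof. by rewrite /antisympart linearZ/= linearB/= trmxK -scalerN opprB. Qed.

Lemma sympartDantisympart (R : realType) (n : nat) (A : 'M[R]_n) :
  sympart A + antisympart A = A.
Proof. by apply/matrixP => i j; rewrite !mxE; field. Qed.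

(** Moving the matrix to the other argument flips the sign, so the number equals its own
    negative. *)
Lemma dot_antisympart (R : realType) (n : nat) (A : 'M[R]_n) (x : 'cV[R]_n) :
  dot (antisympart A *m x) x = 0.
Proof.
have := dot_mulmxl R n (antisympart A) x x.
by rewrite tr_antisympart mulNmx dotNr (dotC x) => ?; lra.
Qed.

Lemma posdef_dot_ge0 (R : realType) (n : nat) (A : 'M[R]_n) (x : 'cV[R]_n) :
  posdef A -> 0 <= dot (A *m x) x.
Proof.
move=> [d d0 Ad]; apply: le_trans (Ad x).
by rewrite mulr_ge0 ?sqr_ge0// ltW.
Qed.

(** A kernel vector $v$ satisfies $\delta |v|^2 \le \langle Av, v\rangle = 0$, so the kernel is
    trivial. *)
Lemma posdef_unitmx (R : realType) (n : nat) (A : 'M[R]_n) :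
  posdef A -> A \in unitmx.
Proof.
move=> [d d0 Ad]; rewrite -unitmx_tr -row_free_unit -kermx_eq0.
apply/rowV0P => u /sub_kermxP u0.
have v0 : A *m u^T = 0 by rewrite -[A]trmxK -trmx_mul u0 trmx0.
have := Ad u^T; rewrite v0 /enorm sqr_sqrtr ?dot_ge0//.
rewrite [leRHS]dotE trmx0 mul0mx mxE pmulr_rle0// => le0.
apply: trmx_inj; rewrite trmx0; apply: dot_eq0; apply/eqP.
by rewrite eq_le le0 dot_ge0.
Qed.

(** With $z = A_s^{-1} y$ the form becomes $\langle A_s z, z\rangle = \langle Az, z\rangle$. *)
Lemma dot_invmx_sympart_ge0 (R : realType) (n : nat) (A : 'M[R]_n)
    (y : 'cV[R]_n) :
  posdef A -> 0 <= dot (invmx (sympart A) *m y) y.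
Proof.
move=> pA; rewrite -{2}(mulKVmx (sympart_unitmx pA) y) dotC dot_sympart.
exact: posdef_dot_ge0.
Qed.

Lemma functionalE (R : realType) (n : nat) (A : 'M[R]_n) (b x : 'cV[R]_n) :
  posdef A ->
  functional A b x =
  2^-1 * dot (invmx (sympart A) *m (A *m x - b)) (A *m x - b).
Proof.
move=> pA; have uS := sympart_unitmx pA.
rewrite /functional; set S := sympart A in uS *; set K := antisympart A.
set r := b - K *m x.
have -> : A *m x - b = S *m x - r.
  by rewrite -{1}(sympartDantisympart R n A) mulmxDl /r opprB addrA.
have rx : dot r x = dot b x by rewrite dotDl dotNl dot_antisympart subr0.
(* The cross term: since $A_s$ is symmetric, it cancels against its inverse. *)
have Srx : dot (invmx S *m r) (S *m x) = dot r x.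
  by rewrite dotC dot_mulmxl tr_sympart mulKVmx// dotC.
clearbody r; rewrite mulmxBr mulKmx// !(dotDl, dotDr, dotNl, dotNr) Srx.
rewrite (dotC x (S *m x)) dot_sympart (dotC x r) rx.
by field.
Qed.

(** The right side minus the left side is exactly $t(1-t)\langle M(x-y), x-y\rangle$. *)
Lemma quadratic_convex (R : realType) (n : nat) (M : 'M[R]_n)
    (t : R) (x y : 'cV[R]_n) :
  (forall z : 'cV[R]_n, 0 <= dot (M *m z) z) -> 0 <= t <= 1 ->
  dot (M *m (t *: x + (1 - t) *: y)) (t *: x + (1 - t) *: y) <=
  t * dot (M *m x) x + (1 - t) * dot (M *m y) y.
Proof.
move=> M0 /andP[t0 t1].
have : 0 <= t * (1 - t) * dot (M *m (x - y)) (x - y).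
  by rewrite !mulr_ge0 ?subr_ge0.
rewrite !(mulmxDr, mulmxN) -!scalemxAr.
rewrite !(dotDl, dotDr, dotNl, dotNr, dotZl, dotZr); lra.
Qed.

Lemma continuous_affine_coord (R : realType) (m n : nat) (M : 'M[R]_(m, n))
    (c : 'cV[R]_m) (i : 'I_m) :
  continuous (fun x : 'cV[R]_n => (M *m x - c) i 0).
Proof.
move=> x; rewrite (_ : (fun _ => _) =
    fun y : 'cV[R]_n => \sum_j M i j * y j 0 - c i 0); last first.
  by apply/funext => y; rewrite !mxE.
apply: (@continuousB _ R^o); last exact: cst_continuous.
apply: continuous_big => [|j _ y]; first exact: add_continuous.
by apply: continuousM; [exact: cst_continuous|exact: coord_continuous].
Qed.

(** The form is a finite sum of products of two coordinates of affine maps. *)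
Lemma continuous_quadratic (R : realType) (m n : nat) (M : 'M[R]_m)
    (A : 'M[R]_(m, n)) (b : 'cV[R]_m) :
  continuous (fun x : 'cV[R]_n => dot (M *m (A *m x - b)) (A *m x - b)).
Proof.
apply: continuous_big => [|i _ x]; first exact: add_continuous.
apply: continuousM; last exact: continuous_affine_coord.
(* The first factor is again affine in $x$, with matrix $MA$ and shift $Mb$. *)
rewrite (_ : (fun _ => _) =
    fun y : 'cV[R]_n => (M *m A *m y - M *m b) i 0); last first.
  by apply/funext => y; rewrite mulmxBr mulmxA.
exact: continuous_affine_coord.
Qed.

Theorem proposition1p1 (R : realType) (n : nat) (A : 'M[R]_n) (b : 'cV[R]_n) :
  posdef A ->
  [/\ convex_function [set: 'cV[R]_n] (functional A b),
      continuous (functional A b) &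
      exists xbar : 'cV[R]_n,
        [/\ forall x : 'cV[R]_n, functional A b xbar <= functional A b x,
            functional A b xbar = inf (range (functional A b)),
            inf (range (functional A b)) = 0 &
            A *m xbar = b]].
Proof.
move=> pA.
have I_ge0 x : 0 <= functional A b x.
  by rewrite functionalE// mulr_ge0 ?invr_ge0 ?dot_invmx_sympart_ge0.
(* The minimizer is the solution $A^{-1} b$, where the residual $Ax - b$ vanishes. *)
have Axb : A *m (invmx A *m b) = b by rewrite mulKVmx// posdef_unitmx.
have I0 : functional A b (invmx A *m b) = 0.
  rewrite functionalE// Axb subrr dotC.
  by rewrite -(scale0r (0 : 'cV[R]_n)) dotZl mul0r mulr0.
have infI : inf (range (functional A b)) = 0.
  apply/eqP; rewrite eq_le; apply/andP; split.
    rewrite -I0; apply: ge_inf; last by exists (invmx A *m b).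
    by exists 0 => _ [x _ <-].
  apply: lb_le_inf; first by exists (functional A b 0), 0.
  by move=> _ [x _ <-].
split.
- move=> t x y _ _.
  (* The abstract convex combinations unfold to the usual ones, with weight [t%:num] on [x]. *)
  suff : functional A b (t%:num *: (x : 'cV[R]_n) + (1 - t%:num) *: y) <=
      t%:num * functional A b x + (1 - t%:num) * functional A b y by [].
  rewrite !functionalE//.
  (* The weights add up to 1, so the affine residual respects the convex combination. *)
  rewrite (_ : A *m _ - b = t%:num *: (A *m x - b) +
      (1 - t%:num) *: (A *m y - b)); last first.
    rewrite mulmxDr -!scalemxAr !scalerBr addrACA -opprD -scalerDl.
    by rewrite subrKC scale1r.
  rewrite !(mulrCA _ 2^-1) -mulrDr ler_wpM2l ?invr_ge0//.
  apply: quadratic_convex => [z|]; first exact: dot_invmx_sympart_ge0.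
  by rewrite ge0 le1.
(* The factor $\frac12$ is absorbed into the matrix of the quadratic form. *)
- rewrite (_ : functional A b = fun x : 'cV[R]_n =>
      dot (2^-1 *: invmx (sympart A) *m (A *m x - b)) (A *m x - b)); last first.
    by apply/funext => x; rewrite functionalE// -scalemxAl dotZl.
  exact: continuous_quadratic.
- exists (invmx A *m b); split => //; last by rewrite I0 infI.
  by move=> x; rewrite I0.
Qed.
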